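(* Let $\mathbf G$ be an abelian group. (A) The variety $\mathcal S$ of all $\mathbf G$-trivial $\mathbf G$-semilattices is a minimal quasivariety, and it is generated (as a quasivariety) by the two-element $\mathbf G$-semilattice. Except for $\mathcal S$, each minimal quasivariety of $\mathbf G$-semilattices is generated (as a quasivariety) by a $1$-generated $\mathbf G$-semilattice. Furthermore, $\mathcal S$ is the only minimal quasivariety of $\mathbf G$-semilattices whose $1$-generated free algebra is one-element. (B) Let $\mathbf A$ be a nontrivial $1$-generated $\mathbf G$-semilattice, and let $a\in A$ be a fixed element that generates $\mathbf A$. Then the following four conditions are equivalent. (i) $\mathcal Q(\mathbf A)$ is a minimal quasivariety. (ii) For each $b\in A$, if the subalgebra $\mathbf B$ generated by $b$ is not a singleton, then there is an isomorphism $\varphi\colon\mathbf A\to\mathbf B$ such that $\varphi(a)=b$. (iii) $\mathbf A$ is isomorphic to each of its nontrivial $1$-generated subalgebras. (iv) Each nonzero element of $\mathbf A$ generates a subalgebra isomorphic to $\mathbf A$. Moreover, if some (equivalently, each) of the conditions (i), (ii), (iii), (iv) holds, then (v) all nontrivial $1$-generated algebras of $\mathcal Q(\mathbf A)$ are isomorphic to the free algebra $\mathbf F_{\mathcal Q(\mathbf A)}(1)$ of $\mathcal Q(\mathbf A)$ on one generator.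
   Context: Let $\mathbf G=\langle G;\cdot,\mathrm{id}\rangle$ be an abelian group. A $\mathbf G$-semilattice is an algebra $\mathbf A=\langle A;\wedge,G\rangle$ with a binary operation $\wedge$ and each $g\in G$ acting as a unary operation on $A$, such that: $\wedge$ is associative, idempotent and commutative; $\mathrm{id}(x)=x$; $f(g(x))=(f\cdot g)(x)$ for all $f,g\in G$; and $g(x)\wedge g(y)=g(x\wedge y)$ for all $g\in G$. The semilattice order is $x\le y\iff x\wedge y=x$. If a least element exists, it is called the zero and denoted $o$. ''Nonzero element'' means any element different from $o$; if $\mathbf A$ has no zero, every element is nonzero. $\mathbf A$ is trivial if $|A|=1$, and $\mathbf G$-trivial if $g(x)=x$ for all $x\in A$, $g\in G$. The two-element $\mathbf G$-semilattice is the two-element meet-semilattice with every $g\in G$ acting as the identity (the only possible action). $1$-generated means generated by a single element. A quasi-identity is a universally quantified sentence $(p_1\approx q_1\ \&\cdots\&\ p_n\approx q_n)\Rightarrow p\approx q$ with $n\ge 0$ and $p_i,q_i,p,q$ terms. A quasivariety is a class of similar algebras defined by quasi-identities; $\mathcal Q(\mathbf A)$ is the least quasivariety containing $\mathbf A$. A quasivariety is trivial if it consists of trivial algebras. A nontrivial quasivariety is minimal if its only proper subquasivariety is the trivial one. $\mathbf F_{\mathcal R}(1)$ denotes the free algebra of $\mathcal R$ on one free generator. *)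

(* Defs.v *)
From Stdlib Require List.
From mathcomp Require Import all_boot.
From mathcomp Require Import boolp classical_sets.

Set Implicit Arguments.
Unset Strict Implicit.
Unset Printing Implicit Defensive.

Local Open Scope classical_set_scope.
Local Open Scope group_scope.

(* Algebras similar to G-semilattices, with no equation imposed. As usual in
   universal algebra the underlying set is nonempty. *)
Record galgebra (G : groupType) := GAlgebra {
  carrier :> Type;
  meet : carrier -> carrier -> carrier;
  act : G -> carrier -> carrier;
  carrier_inhabited : inhabited carrier }.

Definition is_gsemilattice (G : groupType) (A : galgebra G) : Prop :=
  [/\ associative (@meet G A), idempotent_op (@meet G A)
    & commutative (@meet G A)] /\
  [/\ forall x : A, act 1 x = x,
      forall (f g : G) (x : A), act f (act g x) = act (f * g) x
    & forall (g : G) (x y : A), meet (act g x) (act g y) = act g (meet x y)].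

Definition trivial_alg (G : groupType) (A : galgebra G) : Prop :=
  exists x : A, forall y : A, y = x.

Definition G_trivial (G : groupType) (A : galgebra G) : Prop :=
  forall (g : G) (x : A), act g x = x.

Definition le_alg (G : groupType) (A : galgebra G) (x y : A) : Prop :=
  meet x y = x.

Definition is_zero (G : groupType) (A : galgebra G) (o : A) : Prop :=
  forall x : A, le_alg o x.

Definition nonzero (G : groupType) (A : galgebra G) (x : A) : Prop :=
  ~ is_zero x.

Definition two_gsemilattice (G : groupType) : galgebra G :=
  @GAlgebra G bool andb (fun _ b => b) (inhabits true).

Definition is_hom (G : groupType) (A B : galgebra G) (phi : A -> B) : Prop :=
  (forall x y : A, phi (meet x y) = meet (phi x) (phi y)) /\
  (forall (g : G) (x : A), phi (act g x) = act g (phi x)).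

Definition is_iso (G : groupType) (A B : galgebra G) (phi : A -> B) : Prop :=
  is_hom phi /\ bijective phi.

Definition isomorphic (G : groupType) (A B : galgebra G) : Prop :=
  exists phi : A -> B, is_iso phi.

Definition subuniverse (G : groupType) (A : galgebra G) (S : set A) : Prop :=
  (forall x y : A, S x -> S y -> S (meet x y)) /\
  (forall (g : G) (x : A), S x -> S (act g x)).

Record subalgebra (G : groupType) (A : galgebra G) := Subalgebra {
  sub_set : set A;
  sub_closed : subuniverse sub_set;
  sub_nonempty : sub_set !=set0 }.

Section SubalgebraAlgebra.
Variables (G : groupType) (A : galgebra G) (S : subalgebra A).

Lemma sub_meet_subproof (x y : sub_set S) :
  meet (val x) (val y) \in sub_set S.
Proof.
apply/mem_set; apply: (proj1 (sub_closed S)); apply: set_mem; exact: valP.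
Qed.

Lemma sub_act_subproof (g : G) (x : sub_set S) :
  act g (val x) \in sub_set S.
Proof.
by apply/mem_set; apply: (proj2 (sub_closed S)); apply: set_mem; exact: valP.
Qed.

Lemma sub_inhabited_subproof : inhabited (sub_set S).
Proof. by case: (sub_nonempty S) => x Sx; exists; exists x; exact: mem_set. Qed.

Definition sub_galgebra : galgebra G :=
  @GAlgebra G (sub_set S)
    (fun x y => exist _ (meet (val x) (val y)) (sub_meet_subproof x y))
    (fun g x => exist _ (act g (val x)) (sub_act_subproof g x))
    sub_inhabited_subproof.

End SubalgebraAlgebra.

Coercion sub_galgebra : subalgebra >-> galgebra.

Definition gen_set (G : groupType) (A : galgebra G) (b : A) : set A :=
  smallest (@subuniverse G A) [set b].

Lemma gen_set_closed (G : groupType) (A : galgebra G) (b : A) :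
  subuniverse (gen_set b).
Proof.
split=> [x y Sx Sy T [Tc bT] | g x Sx T [Tc bT]].
- by apply: (proj1 Tc); [apply: Sx | apply: Sy].
- by apply: (proj2 Tc); apply: Sx.
Qed.

Lemma gen_set_nonempty (G : groupType) (A : galgebra G) (b : A) :
  gen_set b !=set0.
Proof. by exists b => T [_]; apply. Qed.

Definition gen_sub (G : groupType) (A : galgebra G) (b : A) : subalgebra A :=
  Subalgebra (gen_set_closed b) (gen_set_nonempty b).

Definition generates (G : groupType) (A : galgebra G) (a : A) : Prop :=
  gen_set a = [set: A].

Definition one_generated (G : groupType) (A : galgebra G) : Prop :=
  exists a : A, generates a.

Inductive term (G : Type) : Type :=
| Var of nat
| Meet of term G & term G
| Act of G & term G.

Fixpoint eval (G : groupType) (A : galgebra G) (v : nat -> A) (t : term G) : A :=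
  match t with
  | Var i => v i
  | Meet s t => meet (eval v s) (eval v t)
  | Act g t => act g (eval v t)
  end.

Definition identity (G : Type) : Type := (term G * term G)%type.

Definition holds_at (G : groupType) (A : galgebra G) (v : nat -> A)
  (e : identity G) : Prop := eval v e.1 = eval v e.2.

Record quasi_identity (G : Type) := QuasiIdentity {
  premises : seq (identity G);
  conclusion : identity G }.

Definition satisfies (G : groupType) (A : galgebra G) (q : quasi_identity G) :
    Prop :=
  forall v : nat -> A,
    (forall e, List.In e (premises q) -> holds_at v e) ->
    holds_at v (conclusion q).

(* Classes of algebras are plain predicates, compared pointwise: "set" is not
   universe polymorphic and cannot be used both for subsets of a carrier and for
   classes of algebras. *)
Definition alg_class (G : groupType) := galgebra G -> Prop.

Definition subclass (G : groupType) (K L : alg_class G) : Prop :=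
  forall A, K A -> L A.

Definition same_class (G : groupType) (K L : alg_class G) : Prop :=
  forall A, K A <-> L A.

Definition variety (G : groupType) (K : alg_class G) : Prop :=
  exists E : identity G -> Prop,
    same_class K (fun A => forall e, E e -> forall v : nat -> A, holds_at v e).

Definition quasivariety (G : groupType) (K : alg_class G) : Prop :=
  exists Q : quasi_identity G -> Prop,
    same_class K (fun A => forall q, Q q -> satisfies A q).

(* The least quasivariety containing A, as the intersection of all of them. *)
Definition Qvar (G : groupType) (A : galgebra G) : alg_class G :=
  fun B => forall L : alg_class G, quasivariety L -> L A -> L B.

Definition trivial_class (G : groupType) (K : alg_class G) : Prop :=
  forall A, K A -> trivial_alg A.

Definition minimal_quasivariety (G : groupType) (K : alg_class G) : Prop :=
  [/\ quasivariety K, ~ trivial_class K &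
      forall L, quasivariety L ->
        (subclass L K /\ ~ same_class L K <-> trivial_class L)].

Definition minimal_quasivariety_of_gsemilattices (G : groupType)
    (K : alg_class G) : Prop :=
  minimal_quasivariety K /\ subclass K (@is_gsemilattice G).

Definition G_trivial_gsemilattices (G : groupType) : alg_class G :=
  fun A => is_gsemilattice A /\ G_trivial A.
Arguments G_trivial_gsemilattices : clear implicits.

(* F is free in K with free generator x: it has the universal mapping property
   for K over {x}. This determines F up to isomorphism. *)
Definition free_on_one (G : groupType) (K : alg_class G) (F : galgebra G)
    (x : F) : Prop :=
  [/\ K F, generates x &
      forall (B : galgebra G) (b : B), K B ->
        exists phi : F -> B, is_hom phi /\ phi x = b].

(* Main.v *)
Require Import Defs.
From mathcomp Require Import all_boot.
From mathcomp Require Import boolp classical_sets.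

Set Implicit Arguments.
Unset Strict Implicit.
Unset Printing Implicit Defensive.

Local Open Scope classical_set_scope.
Local Open Scope group_scope.

(** Because [G] is abelian, each term in one variable, read as a map of a
    [G]-semilattice to itself, is an endomorphism ([pval_hom]): translations
    commute with each other and with meets. Hence a relation [s(a) = t(a)] at a
    generator is an identity of the algebra ([generator_identity]), and a
    1-generated algebra is determined up to isomorphism by the one-variable
    identities that it satisfies ([iso_of_relations]).

    A point fixed by [G] in a 1-generated algebra lies below every translate of
    the generator, so it is the zero ([fixed_zeroP]). Thus an element generates
    a nontrivial subalgebra exactly when it is nonzero, and conditions (i)-(iv)
    all say that nonzero elements are indistinguishable by one-variable
    relations. This common core is the property [uniform]: a relation true at
    one nonzero element is true everywhere. A minimal [Q(A)] coincides with
    [Q(B)] for each nontrivial subalgebra [B], which gives [uniform] when [B] is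
    generated by the given element. Conversely let [A] be uniform and generated
    by [a]. If [s(a) <> t(a)], then [s(x) = t(x)] forces [x] to be the zero of
    [A], so [A] satisfies, for every [g], the quasi-identity from [s(x) = t(x)]
    to [g(x) = x]; therefore a nontrivial 1-generated member of [Q(A)] satisfies
    no more relations than [A] and is isomorphic to it ([uniform_iso]). A
    subquasivariety without nontrivial 1-generated members consists of
    [G]-trivial algebras, and nontrivial ones among them are excluded by the
    quasi-identity stating that, for one [g] moving [a], at most one point is
    fixed by [g] ([uniform_not_two]).

    For the [G]-trivial algebras, principal filters separate points, so each of
    them satisfies the quasi-identities of the two-element semilattice, and that
    semilattice embeds in every nontrivial one. A minimal quasivariety other
    than theirs must contain a nontrivial 1-generated algebra, which then
    generates it. *)

(** * Homomorphisms, terms and quasi-identities *)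

Section Homomorphisms.
Variable G : groupType.
Implicit Types (A B : galgebra G) (s t : term G).

(** Every term serves as a term in one variable when it is evaluated along a
    constant valuation. *)
Definition pval A t (x : A) : A := eval (fun=> x) t.

(** Renaming all variables to a single one turns a relation between values of
    [pval] into an equation fit for a quasi-identity. *)
Fixpoint rename (f : nat -> nat) t : term G :=
  match t with
  | Var i => Var G (f i)
  | Meet s t => Meet (rename f s) (rename f t)
  | Act g t => Act g (rename f t)
  end.

Lemma eval_rename A (v : nat -> A) f t : eval v (rename f t) = eval (v \o f) t.
Proof. by elim: t => //= [s -> t -> | g t ->]. Qed.

Lemma hom_eval A B (phi : A -> B) (v : nat -> A) t :
  is_hom phi -> phi (eval v t) = eval (phi \o v) t.
Proof.
by case=> phiM phiA; elim: t => //= [s <- t <- | g t <-]; rewrite ?phiM ?phiA.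
Qed.

Lemma hom_pval A B (phi : A -> B) t x :
  is_hom phi -> phi (pval t x) = pval t (phi x).
Proof. exact: hom_eval. Qed.

Lemma satisfies_embed A B (phi : A -> B) (q : quasi_identity G) :
  is_hom phi -> injective phi -> satisfies B q -> satisfies A q.
Proof.
move=> hphi iphi Bq v prem; apply: iphi; rewrite !hom_eval //.
by apply: Bq => e /prem eqe; rewrite /holds_at -!hom_eval // eqe.
Qed.

Lemma quasivariety_embed (L : alg_class G) A B (phi : A -> B) :
  quasivariety L -> is_hom phi -> injective phi -> L B -> L A.
Proof.
case=> Q LQ hphi iphi /LQ BQ; apply/LQ => q /BQ.
exact: satisfies_embed hphi iphi.
Qed.

Lemma trivial_satisfies A q : trivial_alg A -> satisfies A q.
Proof.
by case=> o A1 v _; rewrite /holds_at (A1 (eval v _)) [RHS]A1.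
Qed.

Lemma quasivariety_trivial (L : alg_class G) A :
  quasivariety L -> trivial_alg A -> L A.
Proof. by case=> Q LQ A1; apply/LQ => q _; apply: trivial_satisfies. Qed.

Lemma variety_quasivariety (K : alg_class G) : variety K -> quasivariety K.
Proof.
case=> E KE; exists (fun q => premises q = [::] /\ E (conclusion q)) => A.
split=> [/KE AE q [_ Eq] v _ | AQ]; first exact: AE.
apply/KE => e Ee v.
by apply: (AQ (QuasiIdentity [::] e)) => //= ? [].
Qed.

(** The equational theory of a class is its largest possible set of axioms, so
    that only the membership of the models of that theory has to be checked. *)
Lemma variety_of_theory (K : alg_class G) :
  (forall A,
     (forall e : identity G,
        (forall B, K B -> forall v : nat -> B, holds_at v e) ->
        forall v : nat -> A, holds_at v e) -> K A) ->
  variety K.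
Proof.
move=> Kmod.
exists (fun e => forall B, K B -> forall v : nat -> B, holds_at v e) => A.
by split=> [KA e /(_ A KA) | /Kmod].
Qed.

Lemma QvarP A B : Qvar A B <-> forall q, satisfies A q -> satisfies B q.
Proof.
split=> [AB | AB L [Q LQ] /LQ AQ]; last by apply/LQ => q /AQ /AB.
apply: (AB (fun C => forall q, satisfies A q -> satisfies C q)) => //.
by exists (satisfies A).
Qed.

Lemma Qvar_quasivariety A : quasivariety (Qvar A).
Proof. by exists (satisfies A) => B; apply: QvarP. Qed.

Lemma Qvar_self A : Qvar A A. Proof. by apply/QvarP. Qed.

Lemma Qvar_pval A B s t : Qvar A B ->
  (forall x : A, pval s x = pval t x) -> forall x : B, pval s x = pval t x.
Proof.
move=> /QvarP AB st x.
pose q := QuasiIdentity [::] (rename (fun=> 0) s, rename (fun=> 0) t).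
have Aq : satisfies A q.
  by move=> v _; rewrite /holds_at /= !eval_rename; apply: st.
have := AB q Aq (fun=> x) (fun e => False_ind _).
by rewrite /holds_at /= !eval_rename.
Qed.

(** * Generation *)

Lemma gen_setP A (b x : A) : gen_set b x <-> exists t, x = pval t b.
Proof.
split=> [|[t ->] T [[TM TA] /(_ b erefl) Tb]]; last first.
  by elim: t => [i //|s Ts t Tt|g t Tt]; [apply: TM | apply: TA].
move=> /(_ [set x | exists t, x = pval t b]); apply.
split=> [|_ ->]; last by exists (Var G 0).
by split=> [_ _ [s ->] [t ->]|g _ [t ->]]; [exists (Meet s t) | exists (Act g t)].
Qed.

Lemma generatesP A (a : A) :
  generates a <-> forall x, exists t, x = pval t a.
Proof.
split=> [gena x | gena]; first by apply/gen_setP; rewrite gena.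
by apply/seteqP; split=> x // _; apply/gen_setP.
Qed.

Lemma val_hom A (S : subalgebra A) : is_hom (fun x : S => val x : A).
Proof. by []. Qed.

Lemma Qvar_sub A (S : subalgebra A) : Qvar A S.
Proof.
by move=> L qL; apply: quasivariety_embed qL (@val_hom A S) _; apply: val_inj.
Qed.

Definition gen_elt A (b : A) : gen_sub b :=
  exist _ b (mem_set (fun T (ST : _ /\ _) => ST.2 b erefl)).

Lemma gen_elt_generates A (b : A) : generates (gen_elt b).
Proof.
apply/generatesP => x; have /gen_setP[t xt] := set_mem (valP x).
by exists t; apply: val_inj; rewrite (hom_pval _ _ (@val_hom A (gen_sub b))).
Qed.

(** Equality, and not just isomorphism, is available because a subalgebra is
    determined by its underlying set. *)
Lemma gen_sub_generator A (S : subalgebra A) (b : S) :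
  generates b -> S = gen_sub (val b).
Proof.
move=> /generatesP genb.
have eqS : sub_set S = gen_set (val b).
  apply/seteqP; split=> x => [Sx | /gen_setP[t ->]].
    have [t xt] := genb (exist _ x (mem_set Sx)); apply/gen_setP; exists t.
    by rewrite -(hom_pval _ _ (@val_hom A S)) -xt.
  by rewrite -(hom_pval _ _ (@val_hom A S)); apply: set_mem; apply: valP.
rewrite /gen_sub; move: (gen_set_closed _) (gen_set_nonempty _).
case: S b eqS {genb} => S Sc Sn b /= <- Sc' Sn'.
congr Subalgebra; exact: Prop_irrelevance.
Qed.

Lemma hom_of_relations A B (a : A) (b : B) : generates a ->
  (forall s t, pval s a = pval t a -> pval s b = pval t b) ->
  exists phi : A -> B, is_hom phi /\ phi a = b.
Proof.
move=> /generatesP /choice[tm tmE] ab; exists (fun x => pval (tm x) b).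
split; last by apply: (ab _ (Var G 0)); rewrite -tmE.
split=> [x y | g x].
  apply: (ab _ (Meet (tm x) (tm y))).
  by rewrite -tmE /pval /= -!/(pval _ _) -!tmE.
by apply: (ab _ (Act g (tm x))); rewrite -tmE /pval /= -!/(pval _ _) -!tmE.
Qed.

Lemma iso_of_relations A B (a : A) (b : B) : generates a -> generates b ->
  (forall s t, pval s a = pval t a <-> pval s b = pval t b) ->
  exists phi : A -> B, is_iso phi /\ phi a = b.
Proof.
move=> gena genb ab.
have [phi [hphi phia]] := hom_of_relations gena (fun s t => (ab s t).1).
have [psi [hpsi psib]] := hom_of_relations genb (fun s t => (ab s t).2).
exists phi; split=> //; split=> //; exists psi => x.
  by have /generatesP/(_ x)[t ->] := gena; rewrite !hom_pval // phia psib.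
by have /generatesP/(_ x)[t ->] := genb; rewrite !hom_pval // psib phia.
Qed.

(** * Minimality *)

Lemma minimal_quasivarietyP (K : alg_class G) A :
    quasivariety K -> K A -> ~ trivial_alg A ->
    (forall L, quasivariety L -> subclass L K -> ~ trivial_class L ->
       subclass K L) ->
  minimal_quasivariety K.
Proof.
move=> qK KA nA minK; split=> // [/(_ A KA) //|L qL]; split=> [[LK neqLK]|L1].
  by apply: contrapT => /(minK L qL LK) KL; apply: neqLK => B; split; auto.
split=> [B /L1 | LK]; first exact: quasivariety_trivial.
by apply: nA; apply: L1; apply/LK.
Qed.

Lemma minimal_generated (K : alg_class G) B :
  minimal_quasivariety K -> K B -> ~ trivial_alg B -> same_class K (Qvar B).
Proof.
case=> qK _ minK KB nB.
apply: contrapT => neqKB; apply: nB.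
apply: (minK _ (Qvar_quasivariety B)).1; last exact: Qvar_self.
split=> [C | eqKB]; first by apply.
by apply: neqKB => C; split=> /eqKB.
Qed.

End Homomorphisms.

(** * Semilattices with an action *)

Section Semilattices.
Variable G : groupType.
Implicit Types (A B : galgebra G) (s t : term G).

Lemma gsemilattice_variety : variety (@is_gsemilattice G).
Proof.
apply: variety_of_theory => A thA.
pose X := Var G.
have id3 s t (x y z : A) : (forall B, is_gsemilattice B ->
    forall v : nat -> B, holds_at v (s, t)) ->
    eval (nth x [:: x; y; z]) s = eval (nth x [:: x; y; z]) t.
  by move=> th; apply: (thA (s, t) th).
split; split;
  [move=> x y z|move=> x|move=> x y|move=> x|move=> f g x|move=> g x y].
- apply: (id3 (Meet (X 0) (Meet (X 1%N) (X 2)))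
    (Meet (Meet (X 0) (X 1%N)) (X 2)) x y z).
  by move=> B [[mA _ _] _] v; apply: mA.
- by apply: (id3 (Meet (X 0) (X 0)) (X 0) x x x) => B [[_ mI _] _] v; apply: mI.
- apply: (id3 (Meet (X 0) (X 1%N)) (Meet (X 1%N) (X 0)) x y x).
  by move=> B [[_ _ mC] _] v; apply: mC.
- by apply: (id3 (Act 1 (X 0)) (X 0) x x x) => B [_ [a1 _ _]] v; apply: a1.
- apply: (id3 (Act f (Act g (X 0))) (Act (f * g) (X 0)) x x x).
  by move=> B [_ [_ aM _]] v; apply: aM.
- apply: (id3 (Meet (Act g (X 0)) (Act g (X 1%N)))
    (Act g (Meet (X 0) (X 1%N))) x y x).
  by move=> B [_ [_ _ aD]] v; apply: aD.
Qed.

Lemma G_trivial_variety : variety (G_trivial_gsemilattices G).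
Proof.
apply: variety_of_theory => A thA; split.
  have [E eqE] := gsemilattice_variety.
  by apply/eqE => e Ee v; apply: thA => B [/eqE BE _] w; apply: BE.
move=> g x; apply: (thA (Act g (Var G 0), Var G 0) _ (fun=> x)) => B [_ B1] v.
exact: B1.
Qed.

Lemma Qvar_gsemilattice A B : is_gsemilattice A -> Qvar A B -> is_gsemilattice B.
Proof.
by move=> gA; apply; first exact/variety_quasivariety/gsemilattice_variety.
Qed.

Lemma fixed_generator_trivial A (a : A) : is_gsemilattice A -> generates a ->
  (forall g, act g a = a) -> trivial_alg A.
Proof.
move=> [[_ mI _] _] /generatesP gena fixa; exists a => x; have [t ->] := gena x.
by elim: t => //= [s IHs t IHt|g t IHt]; rewrite /pval /= -!/(pval _ _) ?IHs ?IHt.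
Qed.

Lemma sub_gsemilattice A (S : subalgebra A) :
  is_gsemilattice A -> is_gsemilattice S.
Proof. by move=> gA; apply: Qvar_gsemilattice gA (@Qvar_sub _ A S). Qed.

Lemma trivial_gen_subP A (b : A) : is_gsemilattice A ->
  trivial_alg (gen_sub b) <-> forall g, act g b = b.
Proof.
move=> gA; split=> [[o o1] g | fixb].
  by have := o1 (act g (gen_elt b)); rewrite -(o1 (gen_elt b)) => /(congr1 val).
apply: fixed_generator_trivial (sub_gsemilattice _ gA) (gen_elt_generates b) _.
by move=> g; apply: val_inj; apply: fixb.
Qed.

Lemma zero_unique A (x y : A) :
  is_gsemilattice A -> is_zero x -> is_zero y -> x = y.
Proof. by case=> [[_ _ mC] _] x0 y0; rewrite -(x0 y) mC; apply: y0. Qed.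

Lemma zero_fixed A (x : A) g : is_gsemilattice A -> is_zero x -> act g x = x.
Proof.
move=> gA x0; apply: zero_unique => // y; case: gA => _ [a1 aM aD].
have -> : y = act g (act g^-1 y) by rewrite aM mulgV a1.
by rewrite /le_alg aD x0.
Qed.

(** Writing [b] as a meet of translates of [a], it lies below some translate of
    [a], hence below all of them when it is fixed, hence below every element. *)
Lemma fixed_zeroP A (a b : A) : is_gsemilattice A -> generates a ->
  is_zero b <-> forall g, act g b = b.
Proof.
move=> gA /generatesP gena; split=> [b0 g | fixb]; first exact: zero_fixed.
have [[mA mI mC] [a1 aM aD]] := gA.
have [h bh] : exists h, le_alg b (act h a).
  have [t bt] := gena b; have : le_alg b (pval t a) by rewrite /le_alg -bt mI.
  have [k ak] : exists k, le_alg (pval t a) (act k a).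
    elim: t {bt} => [i|s [k ak] t _|g t [k ak]].
    - by exists 1; rewrite a1; apply: mI.
    - exists k; rewrite /le_alg /pval /= -!/(pval _ _).
      by rewrite [meet (pval s a) _]mC -mA ak.
    - by exists (g * k); rewrite /le_alg /pval /= -/(pval _ _) -aM aD ak.
  by move=> bt'; exists k; rewrite /le_alg -bt' -mA ak.
have ba g : le_alg b (act g a).
  by rewrite /le_alg -(mulgVK h g) -aM -{1}(fixb (g * h^-1)) aD bh fixb.
move=> x; have [t ->] := gena x; elim: t => [i|s IHs t IHt|g t IHt].
- by rewrite -[pval _ a]a1; apply: ba.
- by rewrite /le_alg /pval /= -!/(pval _ _) mA IHs IHt.
- by rewrite /le_alg /pval /= -/(pval _ _) -{1}(fixb g) aD IHt fixb.
Qed.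

Lemma gen_sub_nontrivialP A (a b : A) : is_gsemilattice A -> generates a ->
  ~ trivial_alg (gen_sub b) <-> nonzero b.
Proof.
move=> gA gena; have fix0 := fixed_zeroP b gA gena.
have fix1 := trivial_gen_subP b gA.
by split=> nb b0; apply: nb; [apply/fix1/fix0 | apply/fix0/fix1].
Qed.

Lemma generator_nonzero A (a : A) : is_gsemilattice A -> generates a ->
  ~ trivial_alg A -> nonzero a.
Proof.
move=> gA gena nA a0; apply: nA; apply: fixed_generator_trivial gena _ => // g.
exact: zero_fixed.
Qed.

(** * Trivial actions *)

Lemma two_G_trivial : G_trivial_gsemilattices G (two_gsemilattice G).
Proof.
by split=> //; split; split=> //= [x y z|x|x y]; rewrite ?andbA ?andbb // andbC.
Qed.

(** The characteristic map of the principal filter of [c] is a homomorphism to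
    the two-element algebra, and two points that none of these maps separates
    lie below each other. *)
Lemma G_trivial_Qvar_two :
  same_class (G_trivial_gsemilattices G) (Qvar (two_gsemilattice G)).
Proof.
move=> A; split=> [[[[mA mI mC] _] A1] | A2]; last first.
  by apply: A2 two_G_trivial; apply/variety_quasivariety/G_trivial_variety.
apply/QvarP => q twoq v prem.
pose chi (c x : A) : two_gsemilattice G := `[< le_alg c x >].
have chi_hom c : is_hom (chi c).
  split=> [x y|g x]; last by rewrite /chi A1.
  apply/asboolP/andP => [cxy|[/asboolP cx /asboolP cy]].
    split; apply/asboolP; rewrite /le_alg -cxy.
      by rewrite -mA [meet (meet x y) x]mC [meet x (meet x y)]mA mI.
    by rewrite -!mA mI.
  by rewrite /le_alg mA cx cy.
have sep c : chi c (eval v (conclusion q).1) = chi c (eval v (conclusion q).2).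
  rewrite !hom_eval //; apply: twoq => e /prem eqe.
  by rewrite /holds_at -!hom_eval // eqe.
have le_sym x y : (forall c, chi c x = chi c y) -> le_alg x y.
  move=> xy; apply/asboolP; rewrite -[asbool _]/(chi x y) -xy.
  by apply/asboolP/mI.
rewrite /holds_at -(le_sym _ _ sep) mC.
by apply: le_sym => c; rewrite sep.
Qed.

Lemma two_embed (L : alg_class G) B : quasivariety L -> L B ->
  G_trivial_gsemilattices G B -> ~ trivial_alg B -> L (two_gsemilattice G).
Proof.
move=> qL LB [[[mA mI mC] _] B1] nB.
have [x [y [neq le_xy]]] : exists x y : B, x <> y /\ le_alg x y.
  apply: contrapT => noxy; apply: nB; have [z] := carrier_inhabited B.
  have le_eq (x y : B) : le_alg x y -> x = y.
    by move=> xy; apply: contrapT => neq; apply: noxy; exists x, y.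
  exists z => y; have <- : meet y z = y by apply: le_eq; rewrite /le_alg mC mA mI.
  by apply: le_eq; rewrite /le_alg -mA mI.
pose phi (u : two_gsemilattice G) : B := if u : bool then y else x.
apply: (quasivariety_embed (phi := phi)) qL _ _ LB.
  split=> [[] []|g u]; rewrite /phi /= ?mI ?B1 //.
  by rewrite mC.
by move=> [] [] //= xy; case: neq.
Qed.

Lemma G_trivial_minimal : minimal_quasivariety (G_trivial_gsemilattices G).
Proof.
apply: (minimal_quasivarietyP _ two_G_trivial).
- exact/variety_quasivariety/G_trivial_variety.
- by case=> -[] x1; [have := x1 false | have := x1 true].
move=> L qL LS nL A /G_trivial_Qvar_two; apply=> //.
have /existsNP[B /not_implyP[LB nB]] := nL.
exact: two_embed LB (LS B LB) nB.
Qed.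

(** If every point of every member generates a singleton, then all points are
    fixed by [G]. *)
Lemma nontrivial_one_generated (K : alg_class G) : quasivariety K ->
  subclass K (@is_gsemilattice G) -> ~ subclass K (G_trivial_gsemilattices G) ->
  exists (B : galgebra G) (b : B), [/\ K B, generates b & ~ trivial_alg B].
Proof.
move=> qK gK /existsNP[A /not_implyP[KA]] nA.
have /existsNP[b nb] : ~ forall b : A, trivial_alg (gen_sub b).
  move=> A1; apply: nA; split=> [|g x]; first exact: gK.
  exact: (trivial_gen_subP x (gK A KA)).1.
exists (gen_sub b), (gen_elt b); split=> //; last exact: gen_elt_generates.
exact: (@Qvar_sub _ A (gen_sub b) K qK KA).
Qed.

(** * Uniform algebras *)

Definition uniform A : Prop :=
  forall (b : A) s t, nonzero b -> pval s b = pval t b ->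
  forall x : A, pval s x = pval t x.

(** Some [g] moves the generator. A nonzero fixed point of [g] would, by
    uniformity, force [g] to act as the identity; so only the zero can be fixed
    by [g], and this uniqueness fails in the two-element algebra. *)
Lemma uniform_not_two A (a : A) : is_gsemilattice A -> generates a ->
  ~ trivial_alg A -> uniform A -> ~ Qvar A (two_gsemilattice G).
Proof.
move=> gA gena nA uA /QvarP A2.
have /existsNP[g ga] : ~ forall g, act g a = a.
  by move=> fixa; apply: nA; apply: fixed_generator_trivial fixa.
have fix0 (x : A) : act g x = x -> is_zero x.
  move=> gx; apply: contrapT => nx; apply: ga.
  exact: (uA x (Act g (Var G 0)) (Var G 0)).
pose X := Var G.
pose q := QuasiIdentity
  [:: (Act g (X 0), X 0); (Act g (X 1%N), X 1%N)] (X 0, X 1%N).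
have Aq : satisfies A q.
  move=> v prem; apply: zero_unique => //; apply: fix0.
    by apply: (prem (Act g (X 0), X 0)); left.
  by apply: (prem (Act g (X 1%N), X 1%N)); right; left.
pose v : nat -> two_gsemilattice G := fun i => i == 0.
have prem e : List.In e (premises q) -> holds_at v e by case=> [<-|[<-|[]]].
by have := A2 q Aq v prem.
Qed.

Lemma uniform_iso A B (a : A) (b : B) : is_gsemilattice A -> generates a ->
    ~ trivial_alg A -> uniform A -> Qvar A B -> generates b -> ~ trivial_alg B ->
  exists phi : A -> B, is_iso phi /\ phi a = b.
Proof.
move=> gA gena nA uA AB genb nB; have na := generator_nonzero gA gena nA.
apply: (iso_of_relations gena genb) => s t; split=> [sta|stb].
  exact: Qvar_pval AB (uA a s t na sta) b.
apply: contrapT => nsta; apply: nB.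
apply: (fixed_generator_trivial _ genb) => [|g].
  exact: Qvar_gsemilattice AB.
(* A relation failing at [a] holds at most at the zero, which [G] fixes. *)
pose c : term G -> term G := rename (fun=> 0).
pose q := QuasiIdentity [:: (c s, c t)] (Act g (Var G 0), Var G 0).
have Aq : satisfies A q.
  move=> v /(_ (c s, c t) (or_introl erefl)).
  rewrite /holds_at /= !eval_rename => stv.
  by apply: zero_fixed => //; apply: contrapT => /(uA _ s t)/(_ stv a).
have /QvarP/(_ q Aq (fun=> b)) := AB; apply=> e [<-|[]].
by rewrite /holds_at /= !eval_rename.
Qed.

Lemma uniform_free A (a : A) : is_gsemilattice A -> generates a ->
  ~ trivial_alg A -> uniform A -> free_on_one (Qvar A) a.
Proof.
move=> gA gena nA uA; split=> [|//|B b AB]; first exact: Qvar_self.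
apply: (hom_of_relations gena) => s t sta.
exact: Qvar_pval AB (uA a s t (generator_nonzero gA gena nA) sta) b.
Qed.

Lemma uniform_minimal A (a : A) : is_gsemilattice A -> generates a ->
  ~ trivial_alg A -> uniform A -> minimal_quasivariety (Qvar A).
Proof.
move=> gA gena nA uA.
apply: (minimal_quasivarietyP (Qvar_quasivariety A) (@Qvar_self _ A) nA).
move=> L qL LA nL; have gL B : L B -> is_gsemilattice B.
  by move=> /LA; apply: Qvar_gsemilattice.
suff : L A by move=> KA B; apply.
have [|B [b [LB genb nB]]] := nontrivial_one_generated qL gL.
  move=> L1; have /existsNP[B /not_implyP[LB nB]] := nL.
  case: (uniform_not_two gA gena nA uA); apply: LA.
  exact: two_embed LB (L1 B LB) nB.
have [phi [[hphi bphi] _]] := uniform_iso gA gena nA uA (LA B LB) genb nB.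
exact: quasivariety_embed qL hphi (bij_inj bphi) LB.
Qed.

(** * Consequences of commutativity *)

Hypothesis G_abelian : forall f g : G, f * g = g * f.

Lemma pval_hom A t : is_gsemilattice A -> is_hom (@pval G A t).
Proof.
move=> [[mA mI mC] [a1 aM aD]].
have mACA : interchange (@meet G A) (@meet G A).
  by move=> x y z w; rewrite -!mA [meet y (meet z w)]mA [meet y z]mC -mA.
split=> [x y|g x].
  elim: t => //= [s IHs t IHt|h t IHt]; rewrite /pval /= -!/(pval _ _).
    by rewrite IHs IHt mACA.
  by rewrite IHt aD.
elim: t => //= [s IHs t IHt|h t IHt]; rewrite /pval /= -!/(pval _ _).
  by rewrite IHs IHt aD.
by rewrite IHt !aM G_abelian.
Qed.

Lemma generator_identity A (a : A) s t : is_gsemilattice A -> generates a ->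
  pval s a = pval t a -> forall x : A, pval s x = pval t x.
Proof.
move=> gA /generatesP gena sta x; have [p ->] := gena x.
by rewrite -!(hom_pval _ _ (pval_hom p gA)) sta.
Qed.

Lemma uniform_of_gen_subs A : is_gsemilattice A ->
    (forall b : A, nonzero b -> Qvar (gen_sub b) A) ->
  uniform A.
Proof.
move=> gA subA b s t nb stb.
apply: Qvar_pval (subA b nb) _.
apply: generator_identity (sub_gsemilattice _ gA) (gen_elt_generates b) _.
by apply: val_inj; rewrite !(hom_pval _ _ (@val_hom _ A (gen_sub b))).
Qed.

Lemma minimal_uniform A (a : A) : is_gsemilattice A -> generates a ->
  minimal_quasivariety (Qvar A) -> uniform A.
Proof.
move=> gA gena minA; apply: uniform_of_gen_subs => // b nb.
apply/(minimal_generated minA (@Qvar_sub _ A (gen_sub b))); last exact: Qvar_self.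
exact/(gen_sub_nontrivialP b gA gena).
Qed.

Lemma isomorphic_uniform A : is_gsemilattice A ->
  (forall b : A, nonzero b -> isomorphic A (gen_sub b)) -> uniform A.
Proof.
move=> gA iso; apply: uniform_of_gen_subs => // b /iso[phi [hphi bphi]] L qL.
exact: quasivariety_embed qL hphi (bij_inj bphi).
Qed.

End Semilattices.

(** * The classification *)

Theorem theorem4p1 (G : groupType)
    (G_abelian : forall f g : G, (f * g)%g = (g * f)%g) :
  [/\ variety (G_trivial_gsemilattices G),
      minimal_quasivariety_of_gsemilattices (G_trivial_gsemilattices G),
      same_class (G_trivial_gsemilattices G) (Qvar (two_gsemilattice G)),
      forall K : alg_class G,
        minimal_quasivariety_of_gsemilattices K ->
        ~ same_class K (G_trivial_gsemilattices G) ->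
        exists B : galgebra G,
          [/\ is_gsemilattice B, one_generated B & same_class K (Qvar B)]
    & forall K : alg_class G,
        minimal_quasivariety_of_gsemilattices K ->
        exists (F : galgebra G) (x : F),
          free_on_one K x /\
          (trivial_alg F <-> same_class K (G_trivial_gsemilattices G))]
  /\
  (forall (A : galgebra G) (a : A),
    is_gsemilattice A -> ~ trivial_alg A -> generates a ->
    let cond_i := minimal_quasivariety (Qvar A) in
    let cond_ii := forall b : A, ~ trivial_alg (gen_sub b) ->
      exists phi : A -> gen_sub b, is_iso phi /\ val (phi a) = b in
    let cond_iii := forall B : subalgebra A,
      ~ trivial_alg B -> one_generated B -> isomorphic A B in
    let cond_iv := forall b : A, nonzero b -> isomorphic A (gen_sub b) in
    let cond_v := exists (F : galgebra G) (x : F),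
      free_on_one (Qvar A) x /\
      forall B : galgebra G, Qvar A B -> ~ trivial_alg B -> one_generated B ->
        isomorphic B F in
    [<-> cond_i; cond_ii; cond_iii; cond_iv] /\
    ([\/ cond_i, cond_ii, cond_iii | cond_iv] -> cond_v)).
Proof.
set S := G_trivial_gsemilattices G.
have qS : quasivariety S by exact/variety_quasivariety/G_trivial_variety.
have genK K : minimal_quasivariety_of_gsemilattices K -> ~ same_class K S ->
    exists (B : galgebra G) (b : B), [/\ is_gsemilattice B, generates b,
      ~ trivial_alg B & same_class K (Qvar B)].
  move=> [minK gK] neqK; have [qK nK _] := minK.
  (* Without a nontrivial 1-generated member, [K] would be a nontrivial proper
     subquasivariety of [S]. *)
  have [KS|B [b [KB genb nB]]] := nontrivial_one_generated qK gK.
    apply: neqK; have [_ _ minS] := G_trivial_minimal G.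
    by apply: contrapT => neqK; apply: nK; apply/(minS K qK).
  by exists B, b; split=> //; [exact: gK | exact: minimal_generated].
split; first split.
- exact: G_trivial_variety.
- by split=> [|A []//]; exact: G_trivial_minimal.
- exact: G_trivial_Qvar_two.
- move=> K mK /(genK K mK)[B [b [gB genb _ KB]]].
  by exists B; split=> //; exists b.
- move=> K mK; case: (pselect (same_class K S)) => [KS|neqK].
    pose F := @GAlgebra G unit (fun _ _ => tt) (fun _ _ => tt) (inhabits tt).
    have F1 : trivial_alg F by exists tt => -[].
    exists F, tt; split; last by split.
    split=> [||B b /KS[[[_ mI _] _] B1]].
    + by apply/KS; apply: quasivariety_trivial.
    + by apply/generatesP => -[]; exists (Var G 0).
    + by exists (fun=> b); split=> //; split=> [x y|g x]; rewrite ?mI ?B1.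
  have [B [b [gB genb nB KB]]] := genK K mK neqK.
  have minB : minimal_quasivariety (Qvar B).
    by have <- : K = Qvar B; [apply/funext => C; apply/propext/KB | case: mK].
  have [FB _ free] := uniform_free gB genb nB
    (minimal_uniform G_abelian gB genb minB).
  exists B, b; split=> //; split=> [|//|C c /KB]; [exact/KB | exact: free].
move=> A a gA nA gena i ii iii iv.
have i_u : i -> uniform A by exact: (minimal_uniform G_abelian gA gena).
have u_ii : uniform A -> ii.
  move=> uA b nb.
  have [phi [iphi phia]] := uniform_iso gA gena nA uA (@Qvar_sub _ A (gen_sub b))
    (gen_elt_generates b) nb.
  by exists phi; rewrite phia.
have ii_iii : ii -> iii.
  move=> Aii B nB [b /gen_sub_generator eqB]; move: nB; rewrite eqB => nB.
  by have [phi [iphi _]] := Aii _ nB; exists phi.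
have iii_iv : iii -> iv.
  move=> Aiii b nb; apply: Aiii.
    exact/(gen_sub_nontrivialP b gA gena).
  by exists (gen_elt b); apply: gen_elt_generates.
have iv_u : iv -> uniform A by exact: (isomorphic_uniform G_abelian gA).
have u_i := uniform_minimal gA gena nA.
split; first by tfae=> [/i_u/u_ii|/ii_iii|/iii_iv|/iv_u/u_i].
move=> conds; have uA : uniform A by case: conds; auto.
exists A, a; split; first exact: uniform_free.
move=> B AB nB [b genb].
have [phi [[hphi [psi phiK psiK]] phia]] := uniform_iso gA gena nA uA AB genb nB.
exists psi; split; last by exists phi.
by split=> [x y|g x]; apply: (can_inj phiK); rewrite psiK ?hphi.1 ?hphi.2 !psiK.
Qed.
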